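(* Let $f:\mathbb{R}\to\mathbb{C}$ be a Lebesgue measurable function which is not zero almost everywhere, and suppose that for every $c>0$, \[ \lim_{x\to\infty} |f(x)|\, e^{c x\log x}=0 . \] Then the system $\mathcal G(f,\mathbb{R}^2)=\{M_aT_bf: a,b\in\mathbb{R}\}$ of time-frequency translates of $f$ is linearly independent.
   Context: For $a,b\in\mathbb{R}$, $M_aT_bf(x)=e^{2\pi i a x}f(x-b)$. For $\Lambda\subset\mathbb{R}^2$, $\mathcal G(f,\Lambda)=\{M_aT_bf:(a,b)\in\Lambda\}$. Measurable functions equal almost everywhere are identified. $\mathcal G(f,\Lambda)$ is called linearly independent if for every finite set $F\subset\Lambda$ and complex coefficients $c_{(a,b)}$, $(a,b)\in F$, not all zero, the function $\sum_{(a,b)\in F}c_{(a,b)}M_aT_bf$ is not zero almost everywhere. *)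

(* Defs.v *)
From HB Require Import structures.
From mathcomp Require Import all_boot all_order all_algebra.
From mathcomp Require Import all_classical all_reals all_analysis.
From mathcomp Require Import complex.

Set Implicit Arguments.
Unset Strict Implicit.
Unset Printing Implicit Defensive.

Import Order.TTheory GRing.Theory Num.Theory.
Local Open Scope ring_scope.
Local Open Scope classical_set_scope.

(* The real line equipped with the Lebesgue (completed, i.e. Caratheodory)
   sigma-algebra; its carrier is R. *)
Definition LebR (R : realType) :=
  caratheodory_type (wlength (R:=R) idfun)^*%mu.

Definition lebR (R : realType) : set (LebR R) -> \bar R :=
  @completed_lebesgue_measure R.

Definition cmod (R : realType) (z : R[i]) : R :=
  Num.sqrt (complex.Re z ^+ 2 + complex.Im z ^+ 2).

Definition cmeasurable (R : realType) (f : R -> R[i]) : Prop :=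
  measurable_fun (T := LebR R) setT (fun x : LebR R => complex.Re (f x)) /\
  measurable_fun (T := LebR R) setT (fun x : LebR R => complex.Im (f x)).

Definition e2pii (R : realType) (t : R) : R[i] :=
  (cos (2 * pi * t) +i* sin (2 * pi * t))%C.

Definition MT (R : realType) (a b : R) (f : R -> R[i]) (x : R) : R[i] :=
  e2pii (a * x) * f (x - b).

Definition gabor_lin_indep (R : realType) (f : R -> R[i]) (Lam : set (R * R))
  : Prop :=
  forall (F : seq (R * R)) (c : R * R -> R[i]),
    uniq F ->
    (forall p, p \in F -> Lam p) ->
    (exists2 p, p \in F & c p != 0) ->
    ~ {ae lebR (R:=R), forall x : LebR R,
         \sum_(p <- F) c p * MT p.1 p.2 f x = 0}.

(* Main.v *)
(* Group the finite sum by translations and let b be the largest one: the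
   relation reads P(y + b) f(y) = - sum_i c_i e(..) f(y + d_i) with P a nonzero
   trigonometric polynomial and all d_i > 0, so f(y) is controlled by values of
   f further to the right. Iterating N times costs a product of N factors
   1/|P| at points y + sum_i k_i d_i. There are only polynomially many such
   points (k_i <= N), and |{|y| <= T : |P(y + h)| < e^q}| <= C e uniformly in h,
   so for almost every y each factor is at most a fixed power of N, up to a
   constant. The product is then exp(O(N log N)), which the decay of f at
   y + sum_i k_i d_i >= y + N min_i d_i beats; hence f(y) = 0.

   The sublevel estimate is proved by induction on the number of terms:
   multiplying P by an exponential makes one frequency 0, and the derivative
   then has one term fewer. *)
Require Import Defs.
From HB Require Import structures.
From mathcomp Require Import all_boot all_order all_algebra.
From mathcomp Require Import all_classical all_reals all_analysis.
From mathcomp Require Import complex.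
From mathcomp Require Import ring lra.
Import Order.TTheory GRing.Theory Num.Theory.
Import numFieldNormedType.Exports.
Local Open Scope ring_scope.
Local Open Scope classical_set_scope.

Set Implicit Arguments.
Unset Strict Implicit.
Unset Printing Implicit Defensive.

(** * Lebesgue outer measure *)

(** Arguing with the outer measure spares any measurability proof for the sets below; [ae_lebR]
    links its null sets to almost-everywhere statements. *)
Definition leb_outer (R : realType) : {outer_measure set R -> \bar R} :=
  [the {outer_measure set (ocitv_type R) -> \bar R} of
    ((wlength (R:=R) idfun)^*)%mu].

Lemma leb_outer_bigcup_le (R : realType) (A : nat -> set R) (u : nat -> R) (r : R)
    (S : set R) :
  S `<=` \bigcup_n A n -> (forall n, leb_outer R (A n) <= (u n)%:E)%E ->
  (forall n, \sum_(k < n) u k <= r) -> (leb_outer R S <= r%:E)%E.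
Proof.
move=> SA Au ur.
apply: (le_trans (le_outer_measure (leb_outer R) _ _ SA)).
apply: (le_trans (outer_measure_sigma_subadditive (leb_outer R) A)).
apply: lime_le; first by apply: is_cvg_nneseries => *; exact: outer_measure_ge0.
apply: nearW => n; rewrite big_mkord.
apply: (@le_trans _ _ (\sum_(k < n) (u k)%:E)%E); first exact: lee_sum.
by rewrite sumEFin lee_fin.
Qed.

Lemma leb_outer_bigcup0 (R : realType) (A : nat -> set R) :
  (forall n, leb_outer R (A n) = 0) -> leb_outer R (\bigcup_n A n) = 0.
Proof.
move=> A0; apply/eqP; rewrite eq_le outer_measure_ge0 andbT.
apply: (@leb_outer_bigcup_le R A (fun=> 0) 0) => // [n|n]; first by rewrite A0.
by rewrite big1.
Qed.

Lemma leb_outer_fin_le (R : realType) (I : finType) (A : I -> set R) (c : R)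
    (S : set R) :
  S `<=` \bigcup_(i in setT) A i -> (forall i, leb_outer R (A i) <= c%:E)%E ->
  (leb_outer R S <= (#|I|%:R * c)%:E)%E.
Proof.
move=> SA Ac.
have H (s : seq I) :
    (leb_outer R (\big[setU/set0]_(i <- s) A i) <= ((size s)%:R * c)%:E)%E.
  elim: s => [|i s IH]; first by rewrite big_nil outer_measure0 mul0r.
  rewrite big_cons /= -natr1 mulrDl mul1r addrC EFinD.
  by apply: (le_trans (outer_measureU2 _ _ _)); apply: leeD.
rewrite cardE; apply: le_trans (H (enum I)).
apply: le_outer_measure => x /SA[i _ Aix].
by rewrite -bigcup_seq; exists i => //=; rewrite mem_enum.
Qed.

Lemma leb_outer_itv (R : realType) (a b : R) :
  a <= b -> (leb_outer R `[a, b] = (b - a)%:E)%E.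
Proof.
move=> ab; transitivity (@lebesgue_measure R `[a, b]) => //.
rewrite lebesgue_measure_itv /= lte_fin.
by case: ltgtP ab => // -> _; rewrite subrr.
Qed.

(** The set lies in the interval of radius [d] around any of its points; the lost factor 2 is
    harmless. *)
Lemma leb_outer_diam (R : realType) (S : set R) (d : R) : 0 <= d ->
  (forall x y, S x -> S y -> `|x - y| <= d) -> (leb_outer R S <= (2 * d)%:E)%E.
Proof.
move=> d0 Sd; have [[x Sx]|S0] := pselect (S !=set0); last first.
  have -> : S = set0 by rewrite -subset0 => x Sx; apply: S0; exists x.
  by rewrite outer_measure0 lee_fin mulr_ge0.
have -> : 2 * d = (x + d) - (x - d) by ring.
rewrite -leb_outer_itv; last lra.
by apply: le_outer_measure => y /(Sd _ _ Sx); rewrite /= in_itv /= ler_distlC.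
Qed.

(** Translating a cover by open intervals keeps its total length. *)
Lemma leb_outer_shift (R : realType) (A : set R) (h : R) :
  (leb_outer R [set y : R | A (y + h)%R] <= leb_outer R A)%E.
Proof.
rewrite /leb_outer /= !measurable_realfun.outer_measure_open_itv_cover.
apply: ereal_inf_le_tmp => _ /= [F [Fitv AF <-]].
exists (fun n => [set y : R | F n (y + h)]).
  split=> [n|y /= /AF[n _ Fn]]; last by exists n.
  have [[a b] ->] := Fitv n; exists (a - h, b - h) => /=.
  by apply/seteqP; split=> y /=; rewrite !in_itv /= ltrBlDr ltrBrDr.
apply: eq_eseriesr => n _; have [[a b] ->] := Fitv n.
have -> : [set y : R | `]a, b[%classic (y + h)] = `](a - h), (b - h)[%classic.
  by apply/seteqP; split=> y /=; rewrite !in_itv /= ltrBlDr ltrBrDr.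
rewrite !wlength_itv /= !lte_fin ltrD2r.
by case: ifP => // _; rewrite -!EFinD; congr (_%:E); ring.
Qed.

(** From right to left, a set of outer measure zero is Caratheodory measurable. *)
Lemma ae_lebR (R : realType) (P : R -> Prop) :
  {ae lebR (R:=R), forall x : LebR R, P x} <-> leb_outer R [set x | ~ P x] = 0.
Proof.
split.
  move=> [A [_ A0 PA]]; apply/eqP; rewrite eq_le outer_measure_ge0 andbT.
  by rewrite -A0; apply: (le_outer_measure (leb_outer R)).
move=> P0; exists [set x | ~ P x]; split => //.
apply: (@le_caratheodory_measurable R _ (leb_outer R)) => X.
have -> : leb_outer R (X `&` [set x | ~ P x]) = 0.
  apply/eqP; rewrite eq_le outer_measure_ge0 andbT -P0.
  exact: le_outer_measure.
by rewrite add0e; exact: le_outer_measure.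
Qed.

(** * Trigonometric polynomials *)

Lemma cmodE (R : realType) (z : R[i]) : cmod z = Normc.normc z.
Proof. by case: z. Qed.

Lemma cmod_ge0 (R : realType) (z : R[i]) : 0 <= cmod z.
Proof. exact: sqrtr_ge0. Qed.

Lemma cmod0 (R : realType) : cmod (0 : R[i]) = 0.
Proof. by rewrite cmodE Normc.normc0. Qed.

Lemma cmod_eq0 (R : realType) (z : R[i]) : (cmod z == 0) = (z == 0).
Proof.
apply/eqP/eqP => [|->]; last exact: cmod0.
by rewrite cmodE; apply: Normc.eq0_normc.
Qed.

Lemma cmodM (R : realType) (z w : R[i]) : cmod (z * w) = cmod z * cmod w.
Proof. by rewrite !cmodE Normc.normcM. Qed.

Lemma cmodN (R : realType) (z : R[i]) : cmod (- z) = cmod z.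
Proof. by rewrite !cmodE; apply: normcN. Qed.

Lemma ler_cmodD (R : realType) (z w : R[i]) : cmod (z + w) <= cmod z + cmod w.
Proof. by rewrite !cmodE; apply: le_normcD. Qed.

Lemma ler_cmodB (R : realType) (z w : R[i]) : cmod (z - w) <= cmod z + cmod w.
Proof. by rewrite (le_trans (ler_cmodD _ _)) ?cmodN. Qed.

Lemma cmod_real (R : realType) (x : R) : cmod x%:C%C = `|x|.
Proof. by rewrite /cmod /= expr0n addr0 sqrtr_sqr. Qed.

Lemma cmod_le_ReIm (R : realType) (z : R[i]) :
  cmod z <= `|complex.Re z| + `|complex.Im z|.
Proof.
case: z => a b; rewrite /cmod /= -[leRHS]ger0_norm ?addr_ge0// -sqrtr_sqr.
rewrite ler_wsqrtr // sqrrD !real_normK ?num_real //.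
by rewrite -addrA lerD2l lerDr mulrn_wge0 ?mulr_ge0.
Qed.

Lemma ler_cmod_sum (R : realType) (I : Type) (s : seq I) (P : pred I)
    (F : I -> R[i]) :
  cmod (\sum_(i <- s | P i) F i) <= \sum_(i <- s | P i) cmod (F i).
Proof.
elim/big_ind2 : _ => [|x1 x2 y1 y2 h1 h2|//]; first by rewrite cmod0.
by apply: (le_trans (ler_cmodD _ _)); apply: lerD.
Qed.

Lemma cmod_e2pii (R : realType) (t : R) : cmod (e2pii t) = 1.
Proof. by rewrite /cmod /= cos2Dsin2 sqrtr1. Qed.

Lemma e2piiD (R : realType) (s t : R) : e2pii (s + t) = e2pii s * e2pii t.
Proof.
by rewrite /e2pii mulrDr cosD sinD; simpc; rewrite [X in (_ +i* X)%C]addrC.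
Qed.

(** Mean value theorem between 0 and [t]. As [B] has to bound the derivative only there, it may
    depend on [t], which turns linear bounds into quadratic ones. *)
Lemma derive_bound (R : realType) (f df : R -> R) (B t : R) :
  (forall x : R, is_derive x (1 : R) f (df x)) -> f 0 = 0 ->
  (forall x, `|x| <= `|t| -> `|df x| <= B) -> `|f t| <= B * `|t|.
Proof.
move=> fdf f0 dfB.
have cf a b : {within `[a, b], continuous f}.
  apply: continuous_subspaceT => x.
  by apply: differentiable_continuous; apply/derivable1_diffP; case: (fdf x).
have [t0|t0] := leP 0 t.
  have [x] := MVT_segment t0 (fun x _ => fdf x) (cf 0 t).
  rewrite in_itv /= f0 !subr0 => /andP[x0 xt] ->.
  by rewrite normrM ler_wpM2r // dfB // !ger0_norm.
have [x] := MVT_segment (ltW t0) (fun x _ => fdf x) (cf t 0).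
rewrite in_itv /= f0 !sub0r => /andP[tx x0] E.
rewrite -normrN E normrM normrN ler_wpM2r // dfB // (ler0_norm x0) (ltr0_norm t0).
by rewrite lerN2.
Qed.

Lemma norm_sin_le (R : realType) (t : R) : `|sin t| <= `|t|.
Proof.
rewrite -[leRHS]mul1r; apply: (derive_bound (df := cos)) => [|x _].
- exact: sin0.
- exact: cos_max.
Qed.

Lemma norm_cosB1_le (R : realType) (t : R) : `|cos t - 1| <= t ^+ 2.
Proof.
rewrite -real_normK ?num_real // expr2.
apply: (derive_bound (f := fun x => cos x - 1) (df := fun x => - sin x)).
- by move=> x; apply: is_derive_eq; rewrite subr0.
- by rewrite cos0 subrr.
- by move=> x xt; rewrite normrN (le_trans (norm_sin_le _)).
Qed.

Lemma norm_sinB_le (R : realType) (t : R) : `|sin t - t| <= t ^+ 2.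
Proof.
rewrite -real_normK ?num_real // expr2.
apply: (derive_bound (f := fun x => sin x - x) (df := fun x => cos x - 1)).
- by rewrite sin0 subr0.
- move=> x xt; apply: (le_trans _ xt); rewrite -[leRHS]mul1r.
  apply: (derive_bound (f := fun x => cos x - 1) (df := fun x => - sin x)).
  + by move=> y; apply: is_derive_eq; rewrite subr0.
  + by rewrite cos0 subrr.
  + by move=> y _; rewrite normrN sin_max.
Qed.

Lemma e2pii_taylor (R : realType) (t : R) :
  cmod (e2pii t - 1 - (0 +i* (2 * pi * t))%C) <= 2 * (2 * pi * t) ^+ 2.
Proof.
apply: (le_trans (cmod_le_ReIm _)); rewrite /e2pii /= !subr0.
have := norm_cosB1_le (2 * pi * t); have := norm_sinB_le (2 * pi * t); lra.
Qed.

Definition trigp (R : realType) (s : seq (R[i] * R)) (x : R) : R[i] :=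
  \sum_(p <- s) p.1 * e2pii (p.2 * x).

(** The derivative, term by term. A term of frequency 0 stays in the list with coefficient 0. *)
Definition dtrigp (R : realType) (s : seq (R[i] * R)) : seq (R[i] * R) :=
  [seq (p.1 * (0 +i* (2 * pi * p.2))%C, p.2) | p <- s].

Lemma trigp_cons (R : realType) (p : R[i] * R) s x :
  trigp (p :: s) x = p.1 * e2pii (p.2 * x) + trigp s x.
Proof. exact: big_cons. Qed.

(** [L] is uniform in [x] and [y] because the exponentials have modulus 1. *)
Lemma trigp_taylor (R : realType) (s : seq (R[i] * R)) :
  exists2 L, 1 <= L & forall x y,
    cmod (trigp s y - trigp s x - (y - x)%:C%C * trigp (dtrigp s) x)
      <= L * (y - x) ^+ 2.
Proof.
elim: s => [|p s [L L1 IH]].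
  exists 1 => // x y; rewrite /trigp /= !big_nil subrr mulr0 subr0 cmod0 mul1r.
  exact: sqr_ge0.
pose K := cmod p.1 * (2 * (2 * pi * p.2) ^+ 2).
have K0 : 0 <= K.
  by rewrite mulr_ge0 ?cmod_ge0 // mulr_ge0 ?sqr_ge0.
exists (K + L) => [|x y]; first by rewrite (le_trans L1) // lerDr.
rewrite /= !trigp_cons /= [leRHS]mulrDl.
set A := (X in X - _ * _); set D := trigp (dtrigp s) x.
pose h := y - x.
(* Factoring out the exponential at [x] leaves, for the head term, a Taylor remainder at 0. *)
have -> : A - (y - x)%:C%C * (p.1 * (0 +i* (2 * pi * p.2))%C * e2pii (p.2 * x) + D)
   = p.1 * e2pii (p.2 * x)
       * (e2pii (p.2 * h) - 1 - (0 +i* (2 * pi * (p.2 * h)))%C)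
     + (trigp s y - trigp s x - h%:C%C * D).
  rewrite /A.
  have -> : (0 +i* (2 * pi * (p.2 * h)))%C = h%:C%C * (0 +i* (2 * pi * p.2))%C.
    by simpc; congr (_ +i* _)%C; ring.
  rewrite -/h (_ : p.2 * y = p.2 * x + p.2 * h); last by rewrite /h; ring.
  by rewrite e2piiD; ring.
apply: (le_trans (ler_cmodD _ _)); apply: lerD; last exact: IH.
rewrite !cmodM cmod_e2pii mulr1 /K -[leRHS]mulrA ler_wpM2l ?cmod_ge0 //.
apply: (le_trans (e2pii_taylor _)); rewrite -/h.
by rewrite le_eqVlt; apply/orP; left; apply/eqP; ring.
Qed.

(** * Sublevel sets of trigonometric polynomials *)

(** [y] stays in a fixed window while [h] follows the walks to infinity, so the bounds have to be
    uniform in [h]. *)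
Definition sublevel (R : realType) (s : seq (R[i] * R)) (T h e : R) : set R :=
  [set y : R | `|y| <= T /\ cmod (trigp s (y + h)) < e].

Lemma trigp_modulate (R : realType) (s : seq (R[i] * R)) (a x : R) :
  trigp s x = e2pii (a * x) * trigp [seq (p.1, p.2 - a) | p <- s] x.
Proof.
rewrite /trigp big_map mulr_sumr; apply: eq_bigr => p _ /=.
rewrite mulrCA -e2piiD; congr (_ * e2pii _); ring.
Qed.

Lemma cmod_trigp_modulate (R : realType) (s : seq (R[i] * R)) (a x : R) :
  cmod (trigp [seq (p.1, p.2 - a) | p <- s] x) = cmod (trigp s x).
Proof. by rewrite (trigp_modulate s a) cmodM cmod_e2pii mul1r. Qed.

(** With u = |y - x|, the Taylor bound gives u sg <= 2 dl + L u^2, and closeness of the points gives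
    L u^2 <= u sg / 2, so the quadratic error is absorbed. *)
Lemma sublevel_diam (R : realType) (s : seq (R[i] * R)) (L sg dl x y : R) :
  (forall x y, cmod (trigp s y - trigp s x - (y - x)%:C%C * trigp (dtrigp s) x)
      <= L * (y - x) ^+ 2) ->
  0 < sg -> sg <= cmod (trigp (dtrigp s) x) ->
  2 * L * `|y - x| <= sg ->
  cmod (trigp s x) < dl -> cmod (trigp s y) < dl -> `|y - x| <= 4 * dl / sg.
Proof.
move=> HL sg0 dx Lxy sx sy; rewrite ler_pdivlMr //.
set u := `|y - x| in Lxy *.
have u0 : 0 <= u by rewrite normr_ge0.
have H1 : u * cmod (trigp (dtrigp s) x) <= 2 * dl + L * u ^+ 2.
  rewrite {1}/u -cmod_real -cmodM.
  have -> : (y - x)%:C%C * trigp (dtrigp s) x = (trigp s y - trigp s x) -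
    (trigp s y - trigp s x - (y - x)%:C%C * trigp (dtrigp s) x) by ring.
  apply: (le_trans (ler_cmodB _ _)); apply: lerD.
    by apply: (le_trans (ler_cmodB _ _)); lra.
  by rewrite (le_trans (HL _ _)) // /u real_normK ?num_real.
have H2 : u * sg <= u * cmod (trigp (dtrigp s) x) by rewrite ler_wpM2l.
have H3 : u * (2 * L * u) <= u * sg by rewrite ler_wpM2l.
rewrite expr2 in H1; lra.
Qed.

Lemma pigeonhole_cell (R : realType) (T r y : R) : 0 < r -> `|y| <= T ->
  exists i : 'I_(Num.truncn (2 * T / r)).+1,
    i%:R * r <= y + T <= i.+1%:R * r.
Proof.
move=> r0; rewrite ler_norml => /andP[y1 y2].
have q0 : 0 <= (y + T) / r by rewrite divr_ge0 ?(ltW r0) //; lra.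
have lt : (Num.truncn ((y + T) / r) < (Num.truncn (2 * T / r)).+1)%N.
  by rewrite ltnS le_truncn // ler_pM2r ?invr_gt0 //; lra.
exists (Ordinal lt) => /=.
have /andP[h1 h2] := truncn_itv q0.
by rewrite -ler_pdivlMr // h1 -ler_pdivrMr // ltW.
Qed.

(* Where the derivative is at least [e ^+ k], a cell of length of order [e ^+ k]
   meets the sublevel set in a set of diameter of order [e ^+ k.+1]; there are
   of order [e ^- k] cells. *)
Lemma sublevel_step (R : realType) (s s' : seq (R[i] * R)) (T C : R)
    (k : nat) : 0 <= T -> 0 < C ->
  trigp (dtrigp s) =1 trigp s' ->
  (forall h e, 0 < e <= 1 ->
    (leb_outer R (sublevel s' T h (e ^+ k)) <= (C * e)%:E)%E) ->
  exists2 C', 0 < C' & forall h e, 0 < e <= 1 ->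
    (leb_outer R (sublevel s T h (e ^+ (k + k).+1)) <= (C' * e)%:E)%E.
Proof.
move=> T0 C0 ss' IH; have [L L1 HL] := trigp_taylor s.
(* [C] pays for the points where the derivative is small. The number [n] of cells satisfies n sg <=
   4 T L + 1, and each cell costs 8 dl / sg = 8 e sg since dl = e sg^2, which dictates the exponent
   [(k + k).+1]. *)
exists (C + 8 * (4 * T * L + 1)) => [|h e /andP[e0 e1]].
  have : 0 <= T * L by rewrite mulr_ge0 // (le_trans _ L1).
  lra.
(* Two points of a cell of length [r] satisfy the closeness condition of [sublevel_diam]. *)
pose sg := e ^+ k; pose dl := e ^+ (k + k).+1; pose r := sg / (2 * L).
have sg0 : 0 < sg by rewrite exprn_gt0.
have sg1 : sg <= 1 by rewrite exprn_ile1 // ltW.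
have dl0 : 0 < dl by rewrite exprn_gt0.
have L0 : 0 < 2 * L by rewrite mulr_gt0 // (lt_le_trans _ L1).
have r0 : 0 < r by rewrite divr_gt0.
pose n := (Num.truncn (2 * T / r)).+1.
pose S (i : 'I_n) := [set y : R | [/\ i%:R * r <= y + T <= i.+1%:R * r,
   cmod (trigp s (y + h)) < dl & sg <= cmod (trigp (dtrigp s) (y + h))]].
have omS i : (leb_outer R (S i) <= (2 * (4 * dl / sg))%:E)%E.
  apply: leb_outer_diam; first by rewrite divr_ge0 ?mulr_ge0 ?ltW.
  move=> x y [/andP[x1 x2] sx dx] [/andP[y1 y2] sy dy].
  have -> : x - y = (x + h) - (y + h) by ring.
  apply: (sublevel_diam HL) => //.
  have -> : (x + h) - (y + h) = x - y by ring.
  rewrite mulrC -ler_pdivlMr // -/r ler_norml.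
  by move: x2 y2; rewrite -natr1 mulrDl; lra.
have sub : sublevel s T h dl `<=`
    sublevel s' T h sg `|` \bigcup_(i in setT) S i.
  move=> y [yT sy]; have [lt|le] := ltP (cmod (trigp s' (y + h))) sg.
    by left.
  right; have [i Hi] := pigeonhole_cell r0 yT.
  by exists i => //; split; rewrite // ss'.
apply: (le_trans (le_outer_measure (leb_outer R) _ _ sub)).
apply: (le_trans (outer_measureU2 _ _ _)).
rewrite mulrDl EFinD; apply: leeD; first by apply: IH; rewrite e0.
apply: (le_trans (leb_outer_fin_le (@subset_refl _ _) omS)).
rewrite lee_fin card_ord.
have n_le : n%:R * sg <= 4 * T * L + 1.
  have q0 : 0 <= 2 * T / r by rewrite divr_ge0 ?(ltW r0) // mulr_ge0.
  have h1 : (Num.truncn (2 * T / r))%:R <= 4 * T * L / sg.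
    have <- : 2 * T / r = 4 * T * L / sg.
      by rewrite /r; field; rewrite !gt_eqF // (lt_le_trans _ L1).
    by case/andP: (truncn_itv q0).
  rewrite ler_pdivlMr // in h1.
  have -> : n%:R = (Num.truncn (2 * T / r))%:R + 1 :> R by rewrite natr1.
  by rewrite mulrDl mul1r lerD.
have dlE : dl = e * sg ^+ 2 by rewrite /dl exprS exprD expr2.
have -> : n%:R * (2 * (4 * dl / sg)) = (n%:R * sg) * (8 * e).
  by rewrite dlE; field; rewrite gt_eqF.
have -> : 8 * (4 * T * L + 1) * e = (4 * T * L + 1) * (8 * e) by ring.
by rewrite ler_wpM2r // mulr_ge0 // ltW.
Qed.

(** Distinct frequencies ensure that, once the head has frequency 0, every other coefficient of the
    derivative is nonzero. Each induction step turns [k] into 2k + 1. *)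
Lemma sublevel_bound (R : realType) (T : R) (s : seq (R[i] * R)) : 0 <= T ->
  s != [::] -> uniq [seq p.2 | p <- s] -> all (fun p => p.1 != 0) s ->
  exists k C, 0 < C /\ forall h e, 0 < e <= 1 ->
    (leb_outer R (sublevel s T h (e ^+ k)) <= (C * e)%:E)%E.
Proof.
move=> T0; have [n] := ubnP (size s); elim: n s => // n IH [|p s] //= sn _.
move=> /andP[ps us] /andP[p0 s0]; rewrite ltnS in sn.
have pc : 0 < cmod p.1 by rewrite lt0r cmod_eq0 p0 cmod_ge0.
case: (altP (s =P [::])) => [->|snil].
  (* A single term has constant modulus, so the set is empty unless e > |p.1|; then the whole
     window, of diameter 2T, is affordable. The summand 1 keeps the constant positive when T = 0. *)
  exists 1%N, (4 * (T + 1) / cmod p.1); split => [|h e /andP[e0 e1]].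
    by rewrite divr_gt0 // mulr_gt0 // ltr_wpDl.
  have [lt|le] := ltP (cmod p.1) e; last first.
    rewrite (_ : sublevel _ _ _ _ = set0) ?outer_measure0.
      by rewrite lee_fin mulr_ge0 // ?ltW // divr_gt0 // mulr_gt0 // ltr_wpDl.
    rewrite -subset0 => y [_]; rewrite trigp_cons /trigp big_nil addr0.
    by rewrite cmodM cmod_e2pii mulr1 expr1 ltNge le.
  apply: (@le_trans _ _ (2 * (2 * T))%:E).
    apply: leb_outer_diam => [|x y [x1 _] [y1 _]]; first by rewrite mulr_ge0.
    by rewrite (le_trans (ler_normB _ _)) //; lra.
  rewrite lee_fin mulrAC ler_pdivlMr //.
  apply: (@le_trans _ _ (2 * (2 * T) * e)).
    by rewrite ler_wpM2l ?mulr_ge0 // ltW.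
  by rewrite ler_wpM2r ?(ltW e0) //; lra.
pose s1 := [seq (p1.1, p1.2 - p.2) | p1 <- s].
have [||||k [C [C0 HC]]] := IH (dtrigp s1); rewrite ?size_map //.
- by rewrite -size_eq0 !size_map size_eq0.
- rewrite -!map_comp.
  have -> : [seq (snd \o (fun p1 => (p1.1 * (0 +i* (2 * pi * p1.2))%C, p1.2)) \o
      (fun p1 => (p1.1, p1.2 - p.2))) i | i <- s]
    = [seq x - p.2 | x <- [seq p.2 | p <- s]].
    by rewrite -map_comp; apply: eq_map.
  by rewrite map_inj_uniq //; apply: addIr.
- rewrite !all_map; apply/allP => p1 p1s /=.
  rewrite mulf_neq0 ?(allP s0) //.
  rewrite eq_complex /= eqxx /= !mulf_neq0 ?pnatr_eq0 //.
    by rewrite gt_eqF // pi_gt0.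
  rewrite subr_eq0; apply: contraNneq ps => <-.
  by apply/mapP; exists p1.
have [|C' C'0 HC'] :=
    @sublevel_step R ((p.1, 0) :: s1) (dtrigp s1) T C k T0 C0 _ HC.
  by move=> x; rewrite /= trigp_cons /= !mulr0 mul0r add0r.
exists (k + k).+1, C'; split => // h e He.
rewrite (_ : sublevel _ _ _ _ = sublevel ((p.1, 0) :: s1) T h (e ^+ (k + k).+1)).
  exact: HC'.
apply/seteqP; suff E y : cmod (trigp (p :: s) y) = cmod (trigp ((p.1, 0) :: s1) y).
  by split=> y []; rewrite /sublevel /= E.
by rewrite -(cmod_trigp_modulate _ p.2) /= subrr.
Qed.

(** * Iterating the recursion *)

Lemma fact_le_expnn (n : nat) : (n`! <= n ^ n)%N.
Proof.
elim: n => // n IH; rewrite factS expnS leq_mul2l /=.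
apply: (leq_trans IH); case: n {IH} => // n.
by rewrite leq_exp2r.
Qed.

Section Iteration.
Variables (R : realType) (I : finType) (d : I -> R) (g : R -> R).
Variables (y dl M : R) (a : nat).

(** The order of the steps is irrelevant, so walks of N steps have only polynomially many
    endpoints. *)
Definition walk (k : I -> nat) : R := \sum_i (k i)%:R * d i.

Hypothesis g_ge0 : forall x, 0 <= g x.
Hypothesis M_ge0 : 0 <= M.
Hypothesis g_step : forall k : I -> nat,
  g (y + walk k) <=
    M * (\sum_i k i).+2%:R ^+ a * \sum_i g (y + walk k + d i).

Lemma walk_succ (k : I -> nat) (i : I) :
  walk (fun j => k j + (j == i))%N = walk k + d i.
Proof.
rewrite /walk (eq_bigr (fun j => (k j)%:R * d j + (j == i)%:R * d j)).
  rewrite big_split /=; congr (_ + _).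
  rewrite (bigD1 i) //= eqxx mul1r big1 ?addr0 // => j /negPf ->.
  by rewrite mul0r.
by move=> j _; rewrite natrD mulrDl.
Qed.

(** The factors 2^a, ..., (N+1)^a of the successive steps multiply to (N+1)!^a, and each step
    branches into [#|I|] terms. The induction peels off the last step, replacing [B] by the bound it
    implies one step earlier. *)
Lemma walk_iter (N : nat) (B : R) : 0 <= B ->
  (forall k, (\sum_i k i)%N = N -> g (y + walk k) <= B) ->
  g y <= (M * #|I|%:R) ^+ N * (N.+1`!)%:R ^+ a * B.
Proof.
elim: N B => [|N IH] B B0 HB.
  have := HB (fun=> 0%N); rewrite big1 // => /(_ erefl).
  by rewrite /walk big1 => [|i _]; rewrite ?mul0r // addr0 expr0 expr1n !mul1r.
rewrite exprS; set P := _ ^+ N; rewrite factS natrM exprMn.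
have -> : M * #|I|%:R * P * (N.+2%:R ^+ a * (N.+1)`!%:R ^+ a) * B
  = P * (N.+1)`!%:R ^+ a * (M * N.+2%:R ^+ a * (#|I|%:R * B)) by ring.
apply: IH => [|k kN]; first by rewrite !mulr_ge0 ?exprn_ge0.
apply: (le_trans (g_step k)); rewrite kN ler_wpM2l ?mulr_ge0 ?exprn_ge0 //.
rewrite mulr_natl -sumr_const; apply: ler_sum => i _.
rewrite -addrA -walk_succ; apply: HB.
rewrite big_split /= kN (bigD1 i) //= eqxx big1 ?addn0 ?addn1 // => j /negPf ->.
by [].
Qed.

Hypothesis dl_gt0 : 0 < dl.
Hypothesis dl_le : forall i, dl <= d i.
Hypothesis g_decay : forall c, 0 < c ->
  exists X, forall x, X <= x -> g x <= expR (- (c * x * ln x)).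

Lemma walk_ge (k : I -> nat) : (\sum_i k i)%:R * dl <= walk k.
Proof.
rewrite natr_sum mulr_suml /walk; apply: ler_sum => i _.
by rewrite ler_wpM2l.
Qed.

(** If g y > 0, take u = N + 1 large. Decay at the endpoints gives u^(-(a+1)u), against a cost of at
    most M'^u u^(au); what remains, (M'/u)^u, is below g y. *)
Lemma iteration_eq0 : g y = 0.
Proof.
apply/eqP; rewrite eq_le g_ge0 andbT leNgt; apply/negP => gy0.
(* For endpoints x >= u dl / 2 with ln x >= (ln u) / 2, this constant makes c x ln x >= (a+1) u ln
   u. *)
have c0 : 0 < 4 * (a.+1)%:R / dl by rewrite divr_gt0 // mulr_gt0.
have [X HX] := g_decay c0.
pose M' := M * #|I|%:R + 1.
have M'1 : 1 <= M' by rewrite lerDr mulr_ge0.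
(* Thresholds for [u]: [Z1] brings the endpoints into the decay range, [Z2] gives (u dl / 2)^2 >= u
   and hence ln u <= 2 ln x, [Z3] gives N dl - |y| >= u dl / 2, and [Z4] gives M' / u < g y. The
   extra M' in [Z] gives M' / u <= 1. *)
pose Z1 := `|X| * 2 / dl; pose Z2 := 4 / dl ^+ 2.
pose Z3 := 2 + 2 * `|y| / dl; pose Z4 := M' / g y.
have Z1_ge0 : 0 <= Z1 by rewrite divr_ge0 ?(ltW dl_gt0) // mulr_ge0.
have Z2_ge0 : 0 <= Z2 by rewrite divr_ge0 // exprn_ge0 // ltW.
have Z3_ge0 : 0 <= Z3 by rewrite addr_ge0 // divr_ge0 ?(ltW dl_gt0) // mulr_ge0.
have Z4_ge0 : 0 <= Z4 by rewrite divr_ge0 ?(ltW gy0) // (le_trans _ M'1).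
pose Z := Z1 + Z2 + Z3 + Z4 + M'.
pose N := Num.truncn Z; pose u : R := N.+1%:R.
have Zu : Z < u.
  have Z0 : 0 <= Z by rewrite /Z; lra.
  by have /andP[] := truncn_itv Z0.
have u0 : 0 < u by rewrite ltr0n.
have uM : M' <= u by rewrite /Z in Zu; lra.
have uZ1 : `|X| <= u * dl / 2.
  have : Z1 <= u by rewrite /Z in Zu; lra.
  by rewrite /Z1 ler_pdivrMr // ler_pdivlMr.
have uZ2 : 4 <= u * dl ^+ 2.
  have : Z2 <= u by rewrite /Z in Zu; lra.
  by rewrite /Z2 ler_pdivrMr // exprn_gt0.
have uZ3 : dl + `|y| <= u * dl / 2.
  have : Z3 <= u by rewrite /Z in Zu; lra.
  rewrite -(ler_pM2r dl_gt0) /Z3 mulrDl divfK ?gt_eqF //; lra.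
have uZ4 : M' < u * g y.
  have : Z4 < u by rewrite /Z in Zu; lra.
  by rewrite /Z4 ltr_pdivrMr.
pose n := (N.+1 * a.+1)%N.
have HB k : (\sum_i k i)%N = N -> g (y + walk k) <= u^-1 ^+ n.
  move=> kN; have xw := walk_ge k; rewrite kN in xw.
  set x := y + walk k.
  have xu : u * dl / 2 <= x.
    have : u * dl = N%:R * dl + dl by rewrite /u -natr1 mulrDl mul1r.
    have := ler_norm (- y); rewrite normrN /x; lra.
  have udl0 : 0 < u * dl / 2 by rewrite divr_gt0 // mulr_gt0.
  have x0 : 0 < x by exact: lt_le_trans xu.
  apply: (le_trans (HX x _)); first by have := ler_norm X; lra.
  have -> : u^-1 ^+ n = expR (- (n%:R * ln u)).
    by rewrite -mulrN expRM_natl expRN lnK.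
  rewrite ler_expR lerN2.
  have lnu : 0 <= ln u by rewrite ln_ge0 // ler1n.
  have lnx : ln u <= ln x *+ 2.
    rewrite -lnXn // ler_ln ?posrE ?exprn_gt0 //.
    apply: (@le_trans _ _ ((u * dl / 2) ^+ 2)); last first.
      by rewrite lerXn2r ?nnegrE // ltW.
    have -> : (u * dl / 2) ^+ 2 = u * ((u * dl ^+ 2) / 4) by field.
    by rewrite ler_peMr ?(ltW u0) //; lra.
  have -> : n%:R * ln u = (4 * a.+1%:R / dl) * (u * dl / 2) * (ln u / 2).
    by rewrite /n natrM -/u; field; rewrite gt_eqF.
  apply: ler_pM; rewrite ?divr_ge0 //.
  - by rewrite mulr_ge0 ?ltW.
  - by rewrite ler_wpM2l // ltW.
  - by rewrite mulr2n in lnx; lra.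
have := walk_iter _ HB; rewrite exprn_ge0 ?invr_ge0 ?(ltW u0) // => /(_ isT).
apply/negP; rewrite -ltNge; apply: le_lt_trans (_ : M' / u < _); last first.
  by rewrite ltr_pdivrMr // mulrC.
apply: (@le_trans _ _ ((M' / u) ^+ N.+1)); last first.
  rewrite ler_iXnr ?divr_ge0 ?(ltW u0) ?(le_trans _ M'1) //.
  by rewrite ler_pdivrMr // mul1r.
pose v := u ^+ N.+1; have v0 : 0 < v by rewrite exprn_gt0.
have -> : (M' / u) ^+ N.+1 = M' ^+ N.+1 * v ^+ a * u^-1 ^+ n.
  rewrite /n exprM exprVn -/v exprMn exprVn -/v exprVn (exprS v) -/v.
  have : v ^+ a != 0 by rewrite gt_eqF // exprn_gt0.
  by set w := v ^+ a => w0; field; rewrite w0 gt_eqF.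
rewrite ler_wpM2r ?exprn_ge0 ?invr_ge0 ?(ltW u0) //.
apply: ler_pM; rewrite ?exprn_ge0 ?mulr_ge0 //.
  apply: (@le_trans _ _ (M' ^+ N)).
    apply: lerXn2r; rewrite ?nnegrE ?mulr_ge0 //.
      by rewrite (le_trans _ M'1).
    by rewrite /M' lerDl.
  by rewrite ler_weXn2l.
rewrite lerXn2r ?nnegrE ?(ltW v0) //.
by rewrite /v /u -natrX ler_nat fact_le_expnn.
Qed.
End Iteration.

(** * Small divisors are avoided from almost every starting point *)

Lemma sum_inv_sq_le1 (R : realType) (n : nat) :
  \sum_(k < n) (k.+2%:R ^- 2 : R) <= 1.
Proof.
(* Telescoping, with 1/(k+2)^2 <= 1/(k+1) - 1/(k+2). *)
suff : \sum_(k < n) (k.+2%:R ^- 2 : R) <= 1 - n.+1%:R^-1.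
  by move=> h; apply: (le_trans h); rewrite gerBl invr_ge0.
elim: n => [|n IH]; first by rewrite big_ord0 invr1 subrr.
rewrite big_ord_recr /=; have n1 : (0 : R) < n.+1%:R by rewrite ltr0n.
have -> : n.+2%:R = n.+1%:R + 1 :> R by rewrite natr1.
move: IH n1; set S := \sum_(_ < _) _; set u : R := n.+1%:R => IH u0.
have : (u + 1) ^- 2 <= u^-1 - (u + 1)^-1.
  have -> : u^-1 - (u + 1)^-1 = (u * (u + 1))^-1.
    by field; rewrite !gt_eqF // addr_gt0.
  rewrite lef_pV2 ?posrE ?exprn_gt0 ?mulr_gt0 ?addr_gt0 // expr2.
  by rewrite ler_wpM2r ?lerDl // addr_ge0 // ltW.
by move=> H; apply: (le_trans (lerD IH H)); rewrite addrA subrK.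
Qed.

Section Recursion.
Variables (R : realType) (I : finType) (d : I -> R) (g : R -> R).
Variables (s : seq (R[i] * R)) (b K dl : R) (N0 : set R).
Hypothesis g_ge0 : forall x, 0 <= g x.
Hypothesis K_ge0 : 0 <= K.
Hypothesis dl_gt0 : 0 < dl.
Hypothesis dl_le : forall i, dl <= d i.
Hypothesis g_decay : forall c, 0 < c ->
  exists X, forall x, X <= x -> g x <= expR (- (c * x * ln x)).
Hypothesis om_N0 : leb_outer R N0 = 0.
Hypothesis g_rec : forall y, ~ N0 y ->
  cmod (trigp s (y + b)) * g y <= K * \sum_i g (y + d i).

(** In the exponent [#|I| + 2], the part [#|I|] pays for the (N+1)^#|I| choices of [k], and 2 makes
    the rest summable over [N]. The power [q] will be the one from [sublevel_bound]. *)
Let bad (T eta : R) (q N : nat) (k : {ffun I -> 'I_N.+1}) : set R :=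
  [set y : R | N0 (y + walk d (fun i => k i))] `|`
  sublevel s T (walk d (fun i => k i) + b) ((eta / N.+2%:R ^+ (#|I| + 2)) ^+ q).

Lemma not_bad_eq0 (T eta : R) (q : nat) (y : R) : 0 < eta -> `|y| <= T ->
  (forall N k, ~ bad T eta q (N := N) k y) -> g y = 0.
Proof.
move=> eta0 yT nbad.
(* Dividing the recursion by the threshold of [bad] yields the constant K / eta^q and the power
   (#|I| + 2) q of N + 2. *)
apply: (@iteration_eq0 R I d g y dl (K / eta ^+ q) ((#|I| + 2) * q)) => //.
  by rewrite divr_ge0 // exprn_ge0 // ltW.
move=> k; set N := (\sum_i k i)%N.
have kN i : (k i < N.+1)%N by rewrite ltnS /N (bigD1 i) //= leq_addr.
(* Each [k i] is at most the sum [N], so [inord] alters no value. *)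
have := nbad N [ffun i => inord (k i)]; rewrite /bad.
have -> : walk d (fun i => [ffun i => inord (k i) : 'I_N.+1] i) = walk d k.
  by apply: eq_bigr => i _; rewrite ffunE inordK.
move=> nb; have nN : ~ N0 (y + walk d k) by move=> h; apply: nb; left.
have := g_rec nN; rewrite -addrA.
set e := (eta / N.+2%:R ^+ (#|I| + 2)) ^+ q in nb *.
have e0 : 0 < e by rewrite exprn_gt0 // divr_gt0 // exprn_gt0.
have le : e <= cmod (trigp s (y + (walk d k + b))).
  by rewrite leNgt; apply/negP => h; apply: nb; right.
move=> h; set S := \sum_i _ in h *.
have -> : K / eta ^+ q * N.+2%:R ^+ ((#|I| + 2) * q) * S = K * S / e.
  rewrite /e expr_div_n exprM.
  have : eta ^+ q != 0 by rewrite gt_eqF // exprn_gt0.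
  have : (N.+2%:R ^+ (#|I| + 2)) ^+ q != 0 :> R.
    by rewrite gt_eqF // !exprn_gt0.
  set v := (_ ^+ _) ^+ q; set w := eta ^+ q => v0 w0.
  by field; rewrite v0 w0.
rewrite ler_pdivlMr // mulrC; apply: le_trans h.
by rewrite ler_wpM2r.
Qed.

Hypothesis s_neq0 : s != [::].
Hypothesis s_uniq : uniq [seq p.2 | p <- s].
Hypothesis s_coef : all (fun p => p.1 != 0) s.

(** In a window, the points where [g] is nonzero lie in the union of the bad sets, of outer measure
    at most C eta; [eta] is arbitrary. *)
Lemma recursion_null : leb_outer R [set y | g y != 0] = 0.
Proof.
suff H n : leb_outer R [set y | `|y| <= n%:R /\ g y != 0] = 0.
  apply/eqP; rewrite eq_le outer_measure_ge0 andbT -(leb_outer_bigcup0 H).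
  apply: le_outer_measure => y gy; exists (Num.truncn `|y|).+1 => //; split=> //.
  by have /andP[_ /ltW] := truncn_itv (normr_ge0 y).
set T : R := n%:R; have T0 : 0 <= T by [].
have [q [C [C0 HC]]] := sublevel_bound T0 s_neq0 s_uniq s_coef.
suff H eta : 0 < eta <= 1 ->
    (leb_outer R [set y : R | (`|y| <= T)%R /\ (g y != 0)%R] <= (C * eta)%:E)%E.
  apply/eqP; rewrite eq_le outer_measure_ge0 andbT.
  apply/lee_addgt0Pr => e e0; rewrite add0e.
  apply: (le_trans (H (Num.min 1 (e / C)) _)).
    by rewrite lt_min ltr01 divr_gt0 //= ge_min lexx.
  by rewrite lee_fin mulrC -ler_pdivlMr // ge_min lexx orbT.
move=> /andP[eta0 eta1].
pose u (N : nat) : R := C * eta * N.+2%:R ^- 2.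
apply: (@leb_outer_bigcup_le R
  (fun N => \bigcup_(k in [set: {ffun I -> 'I_N.+1}]) bad T eta q k) u).
- move=> y [yT gy]; apply: contrapT => nb; move/eqP: gy; apply.
  apply: (not_bad_eq0 eta0 yT (q := q)) => N k bk; apply: nb.
  by exists N => //; exists k.
- move=> N; set e := eta / N.+2%:R ^+ (#|I| + 2).
  have N2 : 1 <= N.+2%:R ^+ (#|I| + 2) :> R by rewrite exprn_ege1 // ler1n.
  have e0 : 0 < e by rewrite divr_gt0 // (lt_le_trans _ N2).
  have e1 : e <= 1.
    by rewrite ler_pdivrMr ?(lt_le_trans _ N2) // mul1r (le_trans eta1).
  have om_bad k : (leb_outer R (bad T eta q (N := N) k) <= (C * e)%:E)%E.
    apply: (le_trans (outer_measureU2 _ _ _)); rewrite -[leRHS]add0e.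
    apply: leeD; last by apply: HC; rewrite e0.
    by apply: (le_trans (leb_outer_shift _ _)); rewrite om_N0.
  apply: (le_trans (leb_outer_fin_le (@subset_refl _ _) om_bad)).
  rewrite lee_fin card_ffun card_ord natrX /u /e exprD.
  have -> : N.+1%:R ^+ #|I| * (C * (eta / (N.+2%:R ^+ #|I| * N.+2%:R ^+ 2)))
      = (N.+1%:R ^+ #|I| / N.+2%:R ^+ #|I|) * (C * eta * N.+2%:R ^- 2) :> R.
    by rewrite invfM; ring.
  rewrite ger_pMl; last by rewrite mulr_gt0 ?mulr_gt0 // invr_gt0 exprn_gt0.
  rewrite ler_pdivrMr ?exprn_gt0 // mul1r lerXn2r ?nnegrE //.
  by rewrite ler_nat.
- move=> N; rewrite /u -mulr_sumr -[leRHS]mulr1 ler_wpM2l //.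
    by rewrite mulr_ge0 // ltW.
  exact: sum_inv_sq_le1.
Qed.
End Recursion.

(** * From a linear relation to the recursion *)

Lemma seq_argmax (R : realType) (T : eqType) (h : T -> R) (s : seq T) (x : T) :
  x \in s -> exists2 m, m \in s & {in s, forall y, h y <= h m}.
Proof.
elim: s x => // a s IH x _; case: s IH => [_|b s IH].
  by exists a; rewrite ?mem_head // => y; rewrite inE => /eqP ->.
have [m ms hm] := IH b (mem_head _ _).
have [am|ma] := leP (h a) (h m).
  by exists m => [|y]; rewrite inE ?ms ?orbT // => /predU1P[->|/hm].
exists a => [|y]; rewrite inE ?eqxx // => /predU1P[->//|/hm ym].
exact: le_trans (ltW ma).
Qed.

Lemma decay_bound (R : realType) (f : R -> R[i]) (c : R) :
  (cmod (f x) * expR (c * x * ln x)) @[x --> +oo] --> 0 ->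
  exists X, forall x, X <= x -> cmod (f x) <= expR (- (c * x * ln x)).
Proof.
move=> /cvgrPdist_le /(_ 1 ltr01) [X [_ HX]].
(* The filter at infinity provides only a strict inequality, hence the shift by 1. *)
exists (X + 1) => x Xx; have /HX : X < x by lra.
rewrite sub0r normrN ger0_norm; last by rewrite mulr_ge0 ?cmod_ge0 ?expR_ge0.
by rewrite expRN -ler_pdivlMr ?expR_gt0 // div1r.
Qed.

Lemma fin_lower_bound (R : realType) (n : nat) (d : 'I_n -> R) :
  (forall i, 0 < d i) -> exists2 dl, 0 < dl & forall i, dl <= d i.
Proof.
(* The default 1 covers n = 0, when all the remaining terms share one translation. *)
move=> d0; exists (\big[Num.min/1]_i d i); last by move=> i; exact: bigmin_le_cond.
by apply: lt_bigmin => // i _.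
Qed.

Unset Implicit Arguments.

Theorem theorem1p1 (R : realType) (f : R -> R[i]) :
  cmeasurable f ->
  ~ {ae lebR (R:=R), forall x : LebR R, f x = 0} ->
  (forall c : R, 0 < c ->
     (cmod (f x) * expR (c * x * ln x)) @[x --> +oo] --> 0) ->
  gabor_lin_indep f setT.
Proof.
move=> _ nf0 fdecay F c uF _ [p1 p1F cp1] /ae_lebR om0.
apply: nf0; apply/ae_lebR.
(* Zero coefficients go first, so that the largest translation is attained by a nonzero term and [s]
   is nonempty. *)
pose F' := [seq p <- F | c p != 0].
have p1F' : p1 \in F' by rewrite mem_filter cp1.
have [p0 p0F' p0max] := seq_argmax (fun p : R * R => p.2) p1F'.
pose b := p0.2.
pose s := [seq (c p, p.1) | p <- F' & p.2 == b].
pose G := [seq p <- F' | p.2 != b].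
pose p_ (i : 'I_(size G)) := nth p0 G i.
pose d i := b - (p_ i).2.
have pG i : p_ i \in G by rewrite mem_nth.
have d0 i : 0 < d i.
  have := pG i; rewrite mem_filter subr_gt0 lt_neqAle => /andP[-> /p0max].
  by [].
have [dl dl0 dl_le] := fin_lower_bound d0.
have -> : [set x | ~ f x = 0] = [set x | cmod (f x) != 0].
  by apply/seteqP; split => x /=; rewrite cmod_eq0 => /eqP.
pose S x := \sum_(p <- F) c p * MT p.1 p.2 f x.
pose N0 := [set y : R | S (y + b) <> 0].
have Sy y : S (y + b) = trigp s (y + b) * f y +
    \sum_i c (p_ i) * e2pii ((p_ i).1 * (y + b)) * f (y + d i).
  rewrite /S (bigID (fun p => c p != 0)) /= [X in _ + X]big1 ?addr0; last first.
    by move=> p; rewrite negbK => /eqP ->; rewrite mul0r.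
  rewrite -big_filter -/F' (bigID (fun p => p.2 == b)) /=; congr (_ + _).
    rewrite /trigp big_map big_filter mulr_suml; apply: eq_bigr => p /eqP pb.
    by rewrite /MT pb addrK mulrA.
  rewrite -big_filter -/G (big_nth p0) big_mkord; apply: eq_bigr => i _.
  by rewrite /MT mulrA /d -addrA.
apply: (@recursion_null R _ d (fun x => cmod (f x)) s b
   (\sum_i cmod (c (p_ i))) dl N0) => //.
- by move=> x; apply: cmod_ge0.
- by apply: sumr_ge0 => i _; apply: cmod_ge0.
- by move=> e e0; apply: decay_bound; apply: fdecay.
(* [N0] is a translate of the null set where the relation fails. *)
- apply/eqP; rewrite eq_le outer_measure_ge0 andbT -om0.
  exact: (leb_outer_shift [set x : R | S x <> 0] b).
- move=> y /contrapT /eqP; rewrite Sy addr_eq0 => /eqP Ey.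
  rewrite -cmodM Ey cmodN mulr_sumr.
  apply: (le_trans (ler_cmod_sum _ _ _)); apply: ler_sum => i _.
  rewrite !cmodM cmod_e2pii mulr1 ler_wpM2r ?cmod_ge0 //.
  by rewrite (bigD1 i) //= lerDl sumr_ge0 // => j _; apply: cmod_ge0.
- apply/eqP => s0; have : (c p0, p0.1) \in s.
    by apply: map_f; rewrite mem_filter eqxx.
  by rewrite s0.
(* Distinct pairs with the same translation [b] have distinct frequencies. *)
- rewrite -map_comp map_inj_in_uniq ?filter_uniq // => -[x1 x2] [y1 y2].
  by rewrite !mem_filter /= => /andP[/eqP -> _] /andP[/eqP -> _] ->.
- rewrite all_map; apply/allP => p; rewrite !mem_filter => /andP[_ /andP[]].
  by [].
Qed.
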